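(* Let $A$ and $B$ be two disjoint bases of a matroid $M$. For any $A_1\subset A$ with $|A_1|=2$ there exists $B_1\subset B$ with $|B_1|=2$ such that $A_1$ and $B_1$ form a serial symmetric exchange relative to $A$ and $B$; that is, one can write $A_1=\{a_1,a_2\}$ and $B_1=\{b_1,b_2\}$ so that $A-a_1+b_1$, $B-b_1+a_1$, $(A\setminus\{a_1,a_2\})\cup\{b_1,b_2\}$ and $(B\setminus\{b_1,b_2\})\cup\{a_1,a_2\}$ are all bases of $M$.
   Context: Notation: $X+x=X\cup\{x\}$, $X-x=X\setminus\{x\}$. For disjoint bases $A,B$ and $X\subseteq A$, $Y\subseteq B$ with $|X|=|Y|=k$, $(X,Y)$ is a serial symmetric exchange relative to $A$ and $B$ if there are orderings $X=\{a_1\prec\cdots\prec a_k\}$, $Y=\{b_1\prec\cdots\prec b_k\}$ such that for each $i=1,\dots,k$ both $(A\setminus\{a_1,\dots,a_i\})\cup\{b_1,\dots,b_i\}$ and $(B\setminus\{b_1,\dots,b_i\})\cup\{a_1,\dots,a_i\}$ are bases. *)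

(* Defs.v *)
From mathcomp Require Import all_boot.

Set Implicit Arguments.
Unset Strict Implicit.
Unset Printing Implicit Defensive.

(* Finite matroids are axiomatized by their bases; the ground set is all of T. *)
Record matroid (T : finType) := Matroid {
  bases : {set {set T}};
  bases_neq0 : bases != set0;
  bases_exchange : forall A B : {set T}, A \in bases -> B \in bases ->
    forall a, a \in A :\: B ->
    exists2 b, b \in B :\: A & b |: (A :\ a) \in bases
}.

(* The orderings a_1 < ... < a_k of X and b_1 < ... < b_k of Y are the
   duplicate-free sequences s and t; {a_1, ..., a_i} is [set:: take i s]. *)
Definition serial_symmetric_exchange (T : finType) (M : matroid T)
    (A B X Y : {set T}) : Prop :=
  [/\ X \subset A, Y \subset B, #|X| = #|Y| &
    exists s t : seq T,
      [/\ uniq s, uniq t, [set:: s] = X, [set:: t] = Y &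
        forall i, 1 <= i <= #|X| ->
          (A :\: [set:: take i s]) :|: [set:: take i t] \in bases M /\
          (B :\: [set:: take i t]) :|: [set:: take i s] \in bases M]].

Lemma serial_symmetric_exchange2P (T : finType) (M : matroid T)
    (A B X Y : {set T}) :
  X \subset A -> Y \subset B -> #|X| = 2 -> #|Y| = 2 ->
  serial_symmetric_exchange M A B X Y <->
  exists a1 a2 b1 b2 : T,
    [/\ X = [set a1; a2], Y = [set b1; b2],
        b1 |: (A :\ a1) \in bases M /\ a1 |: (B :\ b1) \in bases M,
        (A :\: [set a1; a2]) :|: [set b1; b2] \in bases M &
        (B :\: [set b1; b2]) :|: [set a1; a2] \in bases M].
Proof.
have set1s (x : T) : [set:: [:: x]] = [set x] by apply/setP=> z; rewrite !inE.
have set2s (x y : T) : [set:: [:: x; y]] = [set x; y].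
  by apply/setP=> z; rewrite !inE.
move=> sXA sYB cX cY; split.
  case=> _ _ _ [s [t [us ut sX tY exch]]].
  have szs : size s = 2 by rewrite -cX -sX cardsE; apply/esym/card_uniqP.
  have szt : size t = 2 by rewrite -cY -tY cardsE; apply/esym/card_uniqP.
  case: s us sX exch szs => [|a1 [|a2 []]] //= us sX exch _.
  case: t ut tY exch szt => [|b1 [|b2 []]] //= ut tY exch _.
  rewrite cX in exch.
  have [h1 h2] := exch 1 isT; have [h3 h4] := exch 2 isT.
  move: h1 h2 h3 h4; rewrite /= !set1s !set2s => h1 h2 h3 h4.
  exists a1, a2, b1, b2; rewrite -sX -tY !set2s; split=> //.
  by rewrite setUC [a1 |: _]setUC.
case=> a1 [a2 [b1 [b2 [eX eY [h1 h2] h3 h4]]]]; split; rewrite ?cX ?cY //.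
exists [:: a1; a2], [:: b1; b2]; rewrite !set2s -eX -eY.
have neq (x y : T) : #|[set x; y]| = 2 -> uniq [:: x; y].
  by rewrite cards2 /= inE andbT; case: (x == y).
split=> //; try by apply: neq; rewrite -?eX -?eY.
case=> [|[|[|i]]] //= _; rewrite ?set1s ?set2s //.
by rewrite setUC [_ :|: [set a1]]setUC.
Qed.

(* Main.v *)
Require Import Defs.
From mathcomp Require Import all_boot.

(** Fix [a1, a2] in [A] and call [b] in [B] good for [a] when [(a, b)] is a
    symmetric exchange. If [b] is good for [a1], a symmetric exchange of [a2]
    between [A - a1 + b] and [B - b + a1] either proves the theorem or returns
    [a1], so that [b] is good for [a2]; hence in a counterexample [a1] and [a2]
    have the same set [N] of good elements. The relations "[B - b - b' + a1 + a2]
    is not a base" and "[A - a1 - a2 + b + b'] is not a base" are transitive on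
    [N], and any two distinct elements of [N] satisfy one of them; so for each
    [b] in [N] one of them holds between [b] and all of [N]. A further symmetric
    exchange then yields some [b'] outside [N] which, together with [b],
    completes a serial exchange after all. *)

Set Implicit Arguments.
Unset Strict Implicit.
Unset Printing Implicit Defensive.

(* Decides equalities of sets built from singletons, by testing a point against
   every singleton and using the boolean hypotheses in the context. *)
Ltac use_bool_hyps :=
  repeat match goal with
  | H : is_true (~~ ?t) |- context [?t] => rewrite (negPf H)
  | H : is_true (~~ (?x == ?y)) |- context [?y == ?x] =>
      rewrite (eq_sym y x) (negPf H)
  | H : is_true ?t |- context [?t] => rewrite H
  | |- context [?x == ?x] => rewrite eqxx
  end.

Ltac set_dec :=
  let z := fresh "z" in
  apply/setP=> z; rewrite !inE;
  repeat match goal with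
  | |- context [z == ?v] =>
      let e := fresh "e" in
      case: (eqVneq z v) => [e|e]; [rewrite ?e {e}|]; use_bool_hyps => //=
  end; use_bool_hyps; rewrite ?(andbT, andbF, orbT, orbF) //.

(** * Symmetric exchange from the one-sided basis axiom *)

Section SymmetricExchange.

Variables (T : finType) (M : matroid T).
Implicit Types A B C W Z : {set T}.

Lemma bases_antichain A B :
  A \in bases M -> B \in bases M -> A \subset B -> A = B.
Proof.
move=> hA hB sAB; apply/eqP; rewrite eqEsubset sAB /=; apply/subsetP=> x xB.
apply/negPn/negP=> xA.
have [|y] := bases_exchange hB hA (a := x); first by rewrite inE xA xB.
by rewrite inE => /andP[/negP yB /(subsetP sAB)].
Qed.

(* [C] is the fundamental circuit of [a] in [B], without [a]. *)
Lemma fundamental_circuit_dependent B a Z :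
  let C := [set b in B | a |: (B :\ b) \in bases M] in
  B \in bases M -> a \notin B -> Z \in bases M -> a \in Z ->
  ~~ (C \subset Z).
Proof.
move=> C hB aB; have [n] := ubnP #|Z :\: B|.
elim: n Z => // n IHn Z leZn hZ aZ; apply/negP=> sCZ.
have sCB c : c \in C -> c \in B by rewrite inE => /andP[].
(* Any [z != a] of [Z] outside [B] can be exchanged for an element of [B]. This keeps [a] and also
   [C], which lies in [B], and it shrinks [Z :\: B]. *)
have [/eqP ZB|[z]] := set_0Vmem ((Z :\: B) :\ a); last first.
  rewrite !inE => /and3P[zna zB zZ].
  have [|b] := bases_exchange hZ hB (a := z); first by rewrite inE zB zZ.
  rewrite inE => /andP[bZ bB] hZ'.
  suff /negP[] : ~~ (C \subset b |: (Z :\ z)).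
    apply/subsetP=> c cC; rewrite !inE (subsetP sCZ) // andbT orbC.
    by case: eqVneq => // ecz; rewrite -ecz sCB in zB.
  apply: IHn hZ' _; last by rewrite !inE aZ [a == z]eq_sym zna orbT.
  rewrite -ltnS; apply: leq_trans leZn; rewrite ltnS; apply: proper_card.
  apply/properP; split.
    apply/subsetP=> x; rewrite !inE => /andP[xB /orP[/eqP xb|/andP[_ ->]]].
      by rewrite xb bB in xB.
    by rewrite xB.
  exists z; rewrite !inE ?zZ ?zB //= eqxx /= orbF.
  by apply: contraNN zB => /eqP->.
have sZB z : z \in Z -> z != a -> z \in B.
  move=> zZ zna; apply/negPn/negP=> zB.
  by move: ZB => /eqP/setP/(_ z); rewrite !inE zna zB zZ.
(* Now [Z] lies in [B + a], so trading [a] for [b] restores [B]. Hence [Z = B - b + a], which puts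
   [b] in [C] but not in [Z]. *)
have [|b] := bases_exchange hZ hB (a := a); first by rewrite inE aB aZ.
rewrite inE => /andP[bZ bB] hZ'.
have eB : b |: (Z :\ a) = B.
  apply: bases_antichain => //; apply/subsetP=> x; rewrite !inE.
  by case/orP=> [/eqP->//|/andP[xa /sZB->]].
have /(subsetP sCZ) : b \in C; last by rewrite (negPf bZ).
rewrite inE bB /= -eB; suff -> : a |: (b |: Z :\ a) :\ b = Z by [].
apply/setP=> x; rewrite !inE; case: (eqVneq x a) => [->|xa] /=; first by rewrite aZ.
by case: (eqVneq x b) => [->|] //=; rewrite (negPf bZ).
Qed.

(** Starting from [B], elements outside [A :|: C] are exchanged one by one for elements of [A]; none
    of them is in [C], so [C] survives. *)
Lemma base_between A B C :
  A \in bases M -> B \in bases M -> C \subset B ->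
  exists W, [/\ W \in bases M, C \subset W & W \subset A :|: C].
Proof.
move=> hA; have [n] := ubnP #|B :\: (A :|: C)|.
elim: n B => // n IHn W leWn hW sCW.
have [WAC|[w]] := set_0Vmem (W :\: (A :|: C)).
  by exists W; split=> //; rewrite -setD_eq0 WAC.
rewrite !inE negb_or => /andP[/andP[wA wC] wW].
have [|x] := bases_exchange hW hA (a := w); first by rewrite inE wA wW.
rewrite inE => /andP[xW xA] hW'.
apply: (IHn (x |: (W :\ w))) => //.
  rewrite -ltnS; apply: leq_trans leWn; rewrite ltnS; apply: proper_card.
  apply/properP; split; last first.
    exists w; rewrite !inE ?(negPf wA) ?(negPf wC) ?wW //= eqxx orbF.
    by apply: contraNN wA => /eqP->.
  apply/subsetP=> y; rewrite !inE => /andP[yAC /orP[/eqP yx|/andP[_ ->]]].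
    by rewrite yx xA in yAC.
  by rewrite yAC.
apply/subsetP=> c cC; rewrite !inE (subsetP sCW) // andbT orbC.
by case: eqVneq => // ecw; rewrite -ecw cC in wC.
Qed.

(* A base [W] with [C \subset W \subset A :|: C] misses [a], so exchanging [a]
   in [A] against [W] must bring in an element of [C]. *)
Lemma symmetric_exchange A B a :
  A \in bases M -> B \in bases M -> a \in A -> a \notin B ->
  exists b, [/\ b \in B, b \notin A,
    b |: (A :\ a) \in bases M & a |: (B :\ b) \in bases M].
Proof.
move=> hA hB aA aB; pose C := [set b in B | a |: (B :\ b) \in bases M].
have sCB : C \subset B by apply/subsetP=> c; rewrite inE => /andP[].
have [W [hW sCW sWAC]] := base_between hA hB sCB.
have aW : a \notin W.
  apply: contraTN sCW => aW; exact: fundamental_circuit_dependent hB aB hW aW.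
have [|b] := bases_exchange hA hW (a := a); first by rewrite inE aA aW.
rewrite inE => /andP[bA bW] hAb; exists b.
by move/(subsetP sWAC): bW; rewrite in_setU (negPf bA) inE => /andP[].
Qed.

End SymmetricExchange.

(** * Exchanging two elements between disjoint bases *)

Section TwoElements.

Variables (T : finType) (M : matroid T) (A B : {set T}).
Hypotheses (hA : A \in bases M) (hB : B \in bases M) (hAB : [disjoint A & B]).

Let B_notin_A b : b \in B -> b \notin A.
Proof. by move/(disjointFl hAB)->. Qed.

Let A_notin_B a : a \in A -> a \notin B.
Proof. by move/(disjointFr hAB)->. Qed.

Let AB_neq a b : a \in A -> b \in B -> a != b.
Proof. by move=> aA /B_notin_A; apply: contraNneq => <-. Qed.

Definition into_A a b := b |: (A :\ a) \in bases M.
Definition into_B a b := a |: (B :\ b) \in bases M.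
Definition into_A2 a1 a2 b1 b2 :=
  (A :\: [set a1; a2]) :|: [set b1; b2] \in bases M.
Definition into_B2 a1 a2 b1 b2 :=
  (B :\: [set b1; b2]) :|: [set a1; a2] \in bases M.

Lemma into_B2C a1 a2 b b' : into_B2 a1 a2 b b' = into_B2 a1 a2 b' b.
Proof. by rewrite /into_B2 [[set b; b']]setUC. Qed.

Ltac same_base H :=
  rewrite /into_A /into_B /into_A2 /into_B2;
  match type of H with is_true (in_mem ?X _) =>
  match goal with |- is_true (in_mem ?Y _) =>
    have <- : X = Y; [set_dec | exact: H]
  end end.

Definition serial_pair a1 a2 b1 b2 :=
  [&& into_A a1 b1, into_B a1 b1, into_A2 a1 a2 b1 b2 & into_B2 a1 a2 b1 b2].

Lemma second_exchange a1 a2 b :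
  a1 \in A -> a2 \in A -> a1 != a2 -> b \in B -> into_A a1 b -> into_B a1 b ->
  (into_A a2 b /\ into_B a2 b) \/
  exists b', [/\ b' \in B, b != b' & serial_pair a1 a2 b b'].
Proof.
move=> a1A a2A a12 bB xb ab.
have a1B := A_notin_B a1A; have a2B := A_notin_B a2A; have bA := B_notin_A bB.
have a1b := AB_neq a1A bB; have a2b := AB_neq a2A bB.
have [||b'] := symmetric_exchange xb ab (a := a2);
  [by rewrite ?inE; use_bool_hyps|by rewrite ?inE; use_bool_hyps|].
(* If the partner of [a2] is [a1], the two exchanges compose to that of [a2] with [b]. Otherwise the
   partner lies in [B - b] and is the second step of a serial pair. *)
rewrite !inE => -[/orP[/eqP->|/andP[b'b b'B]]].
  move=> _ h1 h2; left; split.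
    by same_base h1.
  by same_base h2.
move=> _ h1 h2; right; exists b'; rewrite eq_sym; split=> //.
have b'A := B_notin_A b'B; have a1b' := AB_neq a1A b'B; have a2b' := AB_neq a2A b'B.
apply/and4P; split=> //.
  by same_base h1.
by same_base h2.
Qed.

(* The negation of [into_A2] is parallelism in the contraction of [M] by
   [A :\: [set a1; a2]], hence this is its transitivity. *)
Lemma into_A2_trans a1 a2 b c d :
  a1 \in A -> a2 \in A -> a1 != a2 -> b \in B -> c \in B -> d \in B ->
  c != b -> c != d -> b != d -> into_A a1 c -> into_A2 a1 a2 b d ->
  into_A2 a1 a2 b c || into_A2 a1 a2 c d.
Proof.
move=> a1A a2A a12 bB cB dB cb cd bd xc qbd.
have [bA cA dA] := And3 (B_notin_A bB) (B_notin_A cB) (B_notin_A dB).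
have [a2b a2c a2d] := And3 (AB_neq a2A bB) (AB_neq a2A cB) (AB_neq a2A dB).
have [a1b a1c a1d] := And3 (AB_neq a1A bB) (AB_neq a1A cB) (AB_neq a1A dB).
have [|x] := bases_exchange xc qbd (a := a2).
  by rewrite !inE; use_bool_hyps.
rewrite !inE => xX hX.
have {xX} : (x == b) || (x == d).
  by move: xX; case: (x \in A) (x == a1) (x == a2) (x == b) (x == d) => [] [] [] [] [];
     rewrite ?andbF ?orbT.
rewrite /into_A2; case/orP=> /eqP ex; rewrite {x}ex in hX; apply/orP; [left|right].
  by same_base hX.
by same_base hX.
Qed.

(** Dually, the negation of [into_B2] is parallelism in the dual of the restriction of [M] to [B :|:
    [set a1; a2]]. There [into_B a1 c] makes [{a2, c}] a base, so [c] is not a loop. *)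
Lemma into_B2_trans a1 a2 b c d :
  a1 \in A -> a2 \in A -> a1 != a2 -> b \in B -> c \in B -> d \in B ->
  c != b -> c != d -> b != d -> into_B a1 c -> into_B2 a1 a2 b d ->
  into_B2 a1 a2 b c || into_B2 a1 a2 c d.
Proof.
move=> a1A a2A a12 bB cB dB cb cd bd ac pbd.
have [a1B a2B] := conj (A_notin_B a1A) (A_notin_B a2A).
have [a2b a2c a2d] := And3 (AB_neq a2A bB) (AB_neq a2A cB) (AB_neq a2A dB).
have [a1b a1c a1d] := And3 (AB_neq a1A bB) (AB_neq a1A cB) (AB_neq a1A dB).
have [|x] := bases_exchange pbd ac (a := c).
  by rewrite !inE; use_bool_hyps.
rewrite !inE => xX hX.
have {xX} : (x == b) || (x == d).
  by move: xX; case: (x \in B) (x == a1) (x == a2) (x == b) (x == d) => [] [] [] [] [];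
     rewrite ?andbF ?orbT.
rewrite /into_B2; case/orP=> /eqP ex; rewrite {x}ex in hX; apply/orP; [right|left].
  by same_base hX.
by same_base hX.
Qed.

(** * Relations between one-element and two-element exchanges *)

Lemma into_A2_into_A a1 a2 b c :
  a1 \in A -> a2 \in A -> a1 != a2 -> b \in B -> c \in B -> b != c ->
  into_A2 a1 a2 b c -> into_A a1 c || into_A a2 c.
Proof.
move=> a1A a2A a12 bB cB bc q.
have [bA cA] := conj (B_notin_A bB) (B_notin_A cB).
have [a1b a1c] := conj (AB_neq a1A bB) (AB_neq a1A cB).
have [a2b a2c] := conj (AB_neq a2A bB) (AB_neq a2A cB).
have [|x] := bases_exchange q hA (a := b); first by rewrite !inE; use_bool_hyps; rewrite orbT.
rewrite !inE => xX hX.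
have {xX} : (x == a1) || (x == a2).
  by move: xX; case: (x \in A) (x == a1) (x == a2) (x == b) (x == c) => [] [] [] [] [];
     rewrite ?andbF ?orbT.
rewrite /into_A; case/orP=> /eqP ex; rewrite {x}ex in hX; apply/orP; [right|left].
  by same_base hX.
by same_base hX.
Qed.

Lemma into_B2_into_B a1 a2 b c :
  a1 \in A -> a2 \in A -> a1 != a2 -> b \in B -> c \in B -> b != c ->
  into_B2 a1 a2 b c -> into_B a1 c || into_B a2 c.
Proof.
move=> a1A a2A a12 bB cB bc p.
have [a1B a2B] := conj (A_notin_B a1A) (A_notin_B a2A).
have [a1b a1c] := conj (AB_neq a1A bB) (AB_neq a1A cB).
have [a2b a2c] := conj (AB_neq a2A bB) (AB_neq a2A cB).
have [|x] := bases_exchange hB p (a := c); first by rewrite !inE; use_bool_hyps; rewrite ?orbT.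
rewrite !inE => xX hX.
have {xX} : (x == a1) || (x == a2).
  by move: xX; case: (x \in B) (x == a1) (x == a2) (x == b) (x == c) => [] [] [] [] [];
     rewrite ?andbF ?orbT.
by rewrite /into_B; case/orP=> /eqP ex; rewrite {x}ex in hX; rewrite hX ?orbT.
Qed.

(** Exchanging [c] out of [B - b + a2] against [B - c + a1] can bring in only [b], giving
    [B - c + a2], or [a1], giving the two-element exchange. *)
Lemma into_B_join a1 a2 b c :
  a1 \in A -> a2 \in A -> a1 != a2 -> b \in B -> c \in B -> b != c ->
  into_B a2 b -> into_B a1 c -> into_B a2 c || into_B2 a1 a2 b c.
Proof.
move=> a1A a2A a12 bB cB bc h2b h1c.
have [a1B a2B] := conj (A_notin_B a1A) (A_notin_B a2A).
have [a1b a1c] := conj (AB_neq a1A bB) (AB_neq a1A cB).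
have [a2b a2c] := conj (AB_neq a2A bB) (AB_neq a2A cB).
have [|x] := bases_exchange h2b h1c (a := c); first by rewrite !inE; use_bool_hyps; rewrite ?orbT.
rewrite !inE => xX hX.
have {xX} : (x == b) || (x == a1).
  by move: xX; case: (x \in B) (x == a1) (x == a2) (x == b) (x == c) => [] [] [] [] [];
     rewrite ?andbF ?orbT.
case/orP=> /eqP ex; rewrite {x}ex in hX; apply/orP; [left|right].
  by same_base hX.
by same_base hX.
Qed.

Lemma into_A_join a1 a2 b c :
  a1 \in A -> a2 \in A -> a1 != a2 -> b \in B -> c \in B -> b != c ->
  into_A a2 b -> into_A a1 c -> into_A a2 c || into_A2 a1 a2 b c.
Proof.
move=> a1A a2A a12 bB cB bc h2b h1c.
have [bA cA] := conj (B_notin_A bB) (B_notin_A cB).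
have [a1b a1c] := conj (AB_neq a1A bB) (AB_neq a1A cB).
have [a2b a2c] := conj (AB_neq a2A bB) (AB_neq a2A cB).
have [|x] := bases_exchange h1c h2b (a := a2); first by rewrite !inE; use_bool_hyps; rewrite ?orbT.
rewrite !inE => xX hX.
have {xX} : (x == a1) || (x == b).
  by move: xX; case: (x \in A) (x == a1) (x == a2) (x == b) (x == c) => [] [] [] [] [];
     rewrite ?andbF ?orbT.
case/orP=> /eqP ex; rewrite {x}ex in hX; apply/orP; [left|right].
  by same_base hX.
by same_base hX.
Qed.

(** Symmetric exchange of [a1] between [A - a2 + b] and [B]. These bases share [b], so the partner
    of [a1] differs from [b]. *)
Lemma exists_into_A2_into_B a1 a2 b :
  a1 \in A -> a2 \in A -> a1 != a2 -> b \in B -> into_A a2 b ->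
  exists c, [/\ c \in B, b != c, into_A2 a1 a2 b c & into_B a1 c].
Proof.
move=> a1A a2A a12 bB yb.
have [bA a1B] := conj (B_notin_A bB) (A_notin_B a1A).
have [a1b a2b] := conj (AB_neq a1A bB) (AB_neq a2A bB).
have [||c [cB cX h1 h2]] := symmetric_exchange yb hB (a := a1);
  [by rewrite ?inE; use_bool_hyps|by rewrite ?inE; use_bool_hyps|].
have bc : b != c by apply: contraNneq cX => <-; rewrite !inE eqxx.
have [cA a1c] := conj (B_notin_A cB) (AB_neq a1A cB); have a2c := AB_neq a2A cB.
exists c; split=> //; same_base h1.
Qed.

(** Symmetric exchange of [a1] between [A] and [B - b + a2]. The partner avoids [A], so it is not
    [a2] and lies in [B - b]. *)
Lemma exists_into_B2_into_A a1 a2 b :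
  a1 \in A -> a2 \in A -> a1 != a2 -> b \in B -> into_B a2 b ->
  exists c, [/\ c \in B, b != c, into_B2 a1 a2 b c & into_A a1 c].
Proof.
move=> a1A a2A a12 bB yb.
have [a1B a2B] := conj (A_notin_B a1A) (A_notin_B a2A).
have [a1b a2b] := conj (AB_neq a1A bB) (AB_neq a2A bB).
have [||c [cX cA h1 h2]] := symmetric_exchange hA yb (a := a1);
  [by rewrite ?inE; use_bool_hyps|by rewrite ?inE; use_bool_hyps|].
have /andP[cb cB] : (c != b) && (c \in B).
  by move: cX; rewrite !inE => /orP[/eqP ec|//]; rewrite ec a2A in cA.
have [a1c a2c] := conj (AB_neq a1A cB) (AB_neq a2A cB).
exists c; rewrite eq_sym; split=> //; same_base h2.
Qed.

(** * Existence of a serial exchange for two given elements *)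

Lemma exists_serial_pair a1 a2 :
  a1 \in A -> a2 \in A -> a1 != a2 ->
  exists b1 b2, [/\ b1 \in B, b2 \in B, b1 != b2 &
    serial_pair a1 a2 b1 b2 || serial_pair a2 a1 b1 b2].
Proof.
move=> a1A a2A a12.
have [/existsP[b1 /existsP[b2 /and4P[? ? ? ?]]]|nex] := boolP
  [exists b1, exists b2, [&& b1 \in B, b2 \in B, b1 != b2 &
    serial_pair a1 a2 b1 b2 || serial_pair a2 a1 b1 b2]].
  by exists b1, b2.
have bad b c : b \in B -> c \in B -> b != c ->
    ~~ (serial_pair a1 a2 b c || serial_pair a2 a1 b c).
  move=> bB cB bc; apply: contraNN nex => h.
  by apply/existsP; exists b; apply/existsP; exists c; apply/and4P.
have N12 b : b \in B -> into_A a1 b -> into_B a1 b -> into_A a2 b /\ into_B a2 b.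
  move=> bB h1 h2; have [//|[c [cB bc h]]] := second_exchange a1A a2A a12 bB h1 h2.
  by have := bad b c bB cB bc; rewrite h.
(* Excluding serial pairs that start with [a2] is what gives this converse. *)
have N21 b : b \in B -> into_A a2 b -> into_B a2 b -> into_A a1 b /\ into_B a1 b.
  rewrite eq_sym in a12.
  move=> bB h1 h2; have [//|[c [cB bc h]]] := second_exchange a2A a1A a12 bB h1 h2.
  by have := bad b c bB cB bc; rewrite h orbT.
pose N := [set b in B | into_A a1 b && into_B a1 b].
pose P := into_B2 a1 a2; pose Q := into_A2 a1 a2.
(* Only [b], which is exchanged first, has to be good; below, [c] may lie outside [N]. *)
have badN b c : b \in N -> c \in B -> b != c -> Q b c -> P b c -> False.
  rewrite inE => /and3P[bB h1 h2] cB bc q p.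
  have /negP[] := bad b c bB cB bc.
  by apply/orP; left; apply/and4P.
have [b [bB _ xb ab]] := symmetric_exchange hA hB a1A (A_notin_B a1A).
have bN : b \in N by rewrite inE; apply/and3P.
have [yb eb] := N12 b bB xb ab.
have [/existsP[d /and3P[dN bd qbd]]|allQ] :=
    boolP [exists d, [&& d \in N, b != d & Q b d]]; last first.
  (* By [allQ] this [c] is not good. So [c] can replace only [a2] in [A], while only [a1] can
     replace [c] in [B]; the latter forces [P b c]. *)
  have [c [cB bc q ac]] := exists_into_A2_into_B a1A a2A a12 bB yb.
  have cN : c \notin N.
    by apply: contraNN allQ => cN; apply/existsP; exists c; apply/and3P.
  have xc : ~~ into_A a1 c by move: cN; rewrite inE cB ac andbT.
  have yc : into_A a2 c.
    by have := into_A2_into_A a1A a2A a12 bB cB bc q; rewrite (negPf xc).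
  have ec : ~~ into_B a2 c by apply: contraNN xc => ec; case: (N21 c cB yc ec).
  have p := into_B_join a1A a2A a12 bB cB bc eb ac.
  by rewrite (negPf ec) in p; case: (badN b c bN cB bc q p).
have dB : d \in B by move: dN; rewrite inE => /andP[].
(* Given [Q b d], suppose [P b c]. Then [c != d], transitivity through [c] leaves only [Q c d], and
   transitivity through [d] leaves only [P d c], so [c] and [d] complete a serial pair. *)
have allP c : c \in N -> b != c -> ~~ P b c.
  move=> cN bc; apply/negP=> p.
  have [cB xc ac] : [/\ c \in B, into_A a1 c & into_B a1 c].
    by move: (cN); rewrite inE => /and3P.
  have [ecd|cd] := eqVneq c d; first by subst d; exact: badN bN cB bc qbd p.
  have q : Q c d.
    have := into_A2_trans a1A a2A a12 bB cB dB _ cd bd xc qbd.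
    by rewrite eq_sym bc => /(_ isT)/orP[q|//]; case: (badN b c bN cB bc q p).
  have ad : into_B a1 d by move: dN; rewrite inE => /and3P[].
  have := into_B2_trans a1A a2A a12 bB dB cB _ _ bc ad p.
  rewrite !(eq_sym d) bd cd => /(_ isT isT)/orP[p'|p'].
    exact: badN bN dB bd qbd p'.
  by rewrite into_B2C in p'; exact: badN cN dB cd q p'.
(* The mirror case: [c] can replace only [a1] in [A], while only [a2] can replace [c] in [B]; the
   former forces [Q b c]. *)
have [c [cB bc p xc]] := exists_into_B2_into_A a1A a2A a12 bB eb.
have cN : c \notin N by apply: contraTN p => cN; apply: allP.
have ac : ~~ into_B a1 c by move: cN; rewrite inE cB xc.
have ec : into_B a2 c.
  by have := into_B2_into_B a1A a2A a12 bB cB bc p; rewrite (negPf ac).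
have yc : ~~ into_A a2 c by apply: contraNN ac => yc; case: (N21 c cB yc ec).
have q := into_A_join a1A a2A a12 bB cB bc yb xc.
by rewrite (negPf yc) in q; case: (badN b c bN cB bc q p).
Qed.

End TwoElements.

Theorem theorem3p3 (T : finType) (M : matroid T) (A B : {set T})
    (hA : A \in bases M) (hB : B \in bases M) (hAB : [disjoint A & B])
    (A1 : {set T}) (hA1 : A1 \subset A) (hA1card : #|A1| = 2) :
  exists B1 : {set T},
    [/\ B1 \subset B, #|B1| = 2 & serial_symmetric_exchange M A B A1 B1].
Proof.
have /cards2P[a1 [a2 [a12 eA1]]] : #|A1| == 2 by apply/eqP.
have [a1A a2A] : a1 \in A /\ a2 \in A.
  by split; apply: (subsetP hA1); rewrite eA1 !inE eqxx ?orbT.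
have [b1 [b2 [b1B b2B b12 h]]] := exists_serial_pair hA hB hAB a1A a2A a12.
have sB : [set b1; b2] \subset B by apply/subsetP=> x; rewrite !inE => /orP[]/eqP->.
have cB : #|[set b1; b2]| = 2 by rewrite cards2 b12.
exists [set b1; b2]; split=> //; apply/serial_symmetric_exchange2P => //.
case/orP: h => /and4P[h1 h2 h3 h4]; first by exists a1, a2, b1, b2.
by exists a2, a1, b1, b2; split=> //; rewrite eA1 setUC.
Qed.
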